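(* Let $\mathcal{C}_1=(\mathrm{A}_1,\Gamma_1)$ and $\mathcal{C}_2=(\mathrm{A}_2,\Gamma_2)$ be contracts and suppose that $\mathcal{C}_1$ is consistent. Then $\mathcal{C}_1$ refines $\mathcal{C}_2$ if and only if $\mathfrak{B}_{\mathrm i}(\mathrm{A}_2)\subset\mathfrak{B}_{\mathrm i}(\mathrm{A}_1)$ and $\mathfrak{B}(\mathrm{A}_2\wedge\Gamma_1)\subset\mathfrak{B}(\Gamma_2)$. In this case (i.e., when $\mathcal{C}_1$ is consistent and refines $\mathcal{C}_2$), the contract $\mathcal{C}_2$ is consistent.
   Context: Fix numbers $m$ of inputs and $p$ of outputs, common to all systems and contracts. $\mathcal{C}^\infty_n$ denotes the space of smooth functions $\mathbb{R}\to\mathbb{R}^n$. All polynomials are univariate with real coefficients; polynomial (rational) matrices are matrices with polynomial (rational function) entries. A rational function is proper if the degree of its denominator is at least the degree of its numerator; a rational matrix is proper if all its entries are. A square polynomial matrix $P(s)$ is invertible if it has an inverse that is a rational matrix. The symbol $\subset$ denotes (not necessarily strict) inclusion. Systems. A system $\Sigma: P\left(\tfrac{d}{dt}\right) y = Q\left(\tfrac{d}{dt}\right) u$, with $u\in\mathcal{C}^\infty_m$, $y\in\mathcal{C}^\infty_p$ and $P(s),Q(s)$ polynomial matrices, is in input-output form if $P(s)$ is (square and) invertible and $P(s)^{-1}Q(s)$ is proper. Its external behaviour is $\mathfrak{B}(\Sigma)=\{(u,y)\in\mathcal{C}^\infty_{m+p} : P(\tfrac{d}{dt})y=Q(\tfrac{d}{dt})u\}$.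 Environments and assumptions. An environment $\mathrm{E}$ is a system $0=E\left(\tfrac{d}{dt}\right)u$ with $u\in\mathcal{C}^\infty_m$ and $E(s)$ a polynomial matrix; its input behaviour is $\mathfrak{B}_{\mathrm i}(\mathrm{E})=\{u\in\mathcal{C}^\infty_m : E(\tfrac{d}{dt})u=0\}$. Assumptions $\mathrm{A}$ are a system of the same form, $0=A\left(\tfrac{d}{dt}\right)u$ with $A(s)$ a polynomial matrix, with input behaviour $\mathfrak{B}_{\mathrm i}(\mathrm{A})$ defined in the same way. Guarantees. Guarantees $\Gamma$ are a system $G\left(\tfrac{d}{dt}\right)y=H\left(\tfrac{d}{dt}\right)u$ with $u\in\mathcal{C}^\infty_m$, $y\in\mathcal{C}^\infty_p$ and arbitrary polynomial matrices $G(s),H(s)$; its external behaviour is $\mathfrak{B}(\Gamma)=\{(u,y)\in\mathcal{C}^\infty_{m+p}: G(\tfrac{d}{dt})y=H(\tfrac{d}{dt})u\}$. Interconnection. For an environment (or assumptions) $\mathrm{E}$ and a system or guarantees $\mathrm{F}$ in the variables $(u,y)$, $\mathrm{E}\wedge \mathrm{F}$ is the system obtained by imposing both sets of equations, so $\mathfrak{B}(\mathrm{E}\wedge \mathrm{F})=\{(u,y)\in\mathfrak{B}(\mathrm{F}): u\in\mathfrak{B}_{\mathrm i}(\mathrm{E})\}$. Contracts. A contract $\mathcal{C}=(\mathrm{A},\Gamma)$ is a pair of assumptions $\mathrm{A}$ and guarantees $\Gamma$. An environment $\mathrm{E}$ is compatible with $\mathcal{C}$ if $\mathfrak{B}_{\mathrm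 i}(\mathrm{E})\subset\mathfrak{B}_{\mathrm i}(\mathrm{A})$. A system $\Sigma$ in input-output form implements $\mathcal{C}$ (is an implementation of $\mathcal{C}$) if $\mathfrak{B}(\mathrm{E}\wedge\Sigma)\subset\mathfrak{B}(\Gamma)$ for all environments $\mathrm{E}$ compatible with $\mathcal{C}$. A contract is consistent if it has at least one implementation. Refinement. The contract $\mathcal{C}_1$ refines the contract $\mathcal{C}_2$ if (1) all environments compatible with $\mathcal{C}_2$ are compatible with $\mathcal{C}_1$, and (2) all implementations of $\mathcal{C}_1$ are implementations of $\mathcal{C}_2$. *)

(* Defs.v *)
From mathcomp Require Export all_boot all_order all_algebra.
From mathcomp Require Export all_classical all_reals all_analysis.
Export numFieldNormedType.Exports.
Set Implicit Arguments.
Unset Strict Implicit.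
Unset Printing Implicit Defensive.
Import Order.TTheory GRing.Theory Num.Theory.
Local Open Scope classical_set_scope.
Local Open Scope ring_scope.

Definition smooth (R : realType) (f : R -> R) : Prop :=
  forall (k : nat) (t : R), derivable (derive1n k f) t 1.

Definition smooth_signal (R : realType) (n : nat) : set (R -> 'cV[R]_n) :=
  [set w | forall i : 'I_n, smooth (fun t => w t i ord0)].

(* [diffop a f] is a(d/dt) f, and [mxdiffop M w] is M(d/dt) w. *)
Definition diffop (R : realType) (a : {poly R}) (f : R -> R) : R -> R :=
  fun t => \sum_(k < size a) a`_k * derive1n k f t.

Definition mxdiffop (R : realType) (r n : nat) (M : 'M[{poly R}]_(r, n))
    (w : R -> 'cV[R]_n) : R -> 'cV[R]_r :=
  fun t => \col_i \sum_j diffop (M i j) (fun s => w s j ord0) t.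

Definition ratmx (R : realType) (r n : nat) (M : 'M[{poly R}]_(r, n)) :
    'M[{fraction {poly R}}]_(r, n) :=
  map_mx (@tofrac {poly R}) M.

(* The size of a polynomial is its degree plus one, so [size a <= size b]
   compares degrees; the zero function is proper. *)
Definition proper (R : realType) (q : {fraction {poly R}}) : Prop :=
  exists a b : {poly R},
    [/\ b != 0, q = tofrac a / tofrac b & (size a <= size b)%N].

Definition proper_mx (R : realType) (r n : nat)
    (M : 'M[{fraction {poly R}}]_(r, n)) : Prop :=
  forall i j, proper (M i j).

(* The system lhs_mx(d/dt) y = rhs_mx(d/dt) u, with any number of equations. *)
Record system (R : realType) (m p : nat) := System {
  sys_rows : nat;
  lhs_mx : 'M[{poly R}]_(sys_rows, p);
  rhs_mx : 'M[{poly R}]_(sys_rows, m) }.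

Definition behaviour (R : realType) (m p : nat) (S : system R m p) :
    set ((R -> 'cV[R]_m) * (R -> 'cV[R]_p)) :=
  [set uy | [/\ smooth_signal uy.1, smooth_signal uy.2 &
                mxdiffop (lhs_mx S) uy.2 = mxdiffop (rhs_mx S) uy.1]].

Definition input_output_form (R : realType) (m p : nat) (S : system R m p) :
    Prop :=
  exists (P : 'M[{poly R}]_p) (Q : 'M[{poly R}]_(p, m)),
    [/\ S = System P Q, ratmx P \in unitmx &
        proper_mx (invmx (ratmx P) *m ratmx Q)].

(* The system 0 = env_mx(d/dt) u; used for environments and assumptions. *)
Record environment (R : realType) (m : nat) := Environment {
  env_rows : nat;
  env_mx : 'M[{poly R}]_(env_rows, m) }.

Definition input_behaviour (R : realType) (m : nat) (E : environment R m) :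
    set (R -> 'cV[R]_m) :=
  [set u | smooth_signal u /\ mxdiffop (env_mx E) u = (fun=> 0)].

Definition interconnection (R : realType) (m p : nat) (E : environment R m)
    (F : system R m p) : system R m p :=
  System (col_mx 0 (lhs_mx F)) (col_mx (env_mx E) (rhs_mx F)).

Lemma diffop0 (R : realType) (f : R -> R) (t : R) : diffop 0 f t = 0.
Proof. by rewrite /diffop size_poly0 big_ord0. Qed.

Lemma mxdiffop0 (R : realType) (r n : nat) (w : R -> 'cV[R]_n) :
  mxdiffop (0 : 'M[{poly R}]_(r, n)) w = (fun=> 0).
Proof.
apply/funext => t; apply/colP => i; rewrite !mxE big1// => j _.
by rewrite mxE diffop0.
Qed.

Lemma mxdiffop_col_mx (R : realType) (r1 r2 n : nat)
    (M : 'M[{poly R}]_(r1, n)) (N : 'M[{poly R}]_(r2, n)) (w : R -> 'cV[R]_n) :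
  mxdiffop (col_mx M N) w = (fun t => col_mx (mxdiffop M w t) (mxdiffop N w t)).
Proof.
apply/funext => t; apply/colP => i; rewrite !mxE.
by case: (split_ordP i) => k ->; rewrite ?col_mxEu ?col_mxEd ?mxE;
  apply: eq_bigr => j _; rewrite ?col_mxEu ?col_mxEd.
Qed.

Lemma behaviour_interconnection (R : realType) (m p : nat)
    (E : environment R m) (F : system R m p) :
  behaviour (interconnection E F) =
  [set uy | behaviour F uy /\ input_behaviour E uy.1].
Proof.
apply/seteqP; split=> [[u y]|[u y]] /=.
  move=> [/= su sy]; rewrite !mxdiffop_col_mx mxdiffop0 => eqs.
  have eqt t := eq_col_mx (congr1 (fun f => f t) eqs).
  by split; split=> //; apply/funext => t; have [] := eqt t.
move=> [[/= su sy eqF] [_ eqE]]; split=> //=.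
by rewrite !mxdiffop_col_mx mxdiffop0 eqF eqE.
Qed.

Record contract (R : realType) (m p : nat) := Contract {
  assumptions : environment R m;
  guarantees : system R m p }.

Definition compatible (R : realType) (m p : nat) (E : environment R m)
    (C : contract R m p) : Prop :=
  input_behaviour E `<=` input_behaviour (assumptions C).

Definition implements (R : realType) (m p : nat) (S : system R m p)
    (C : contract R m p) : Prop :=
  input_output_form S /\
  forall E : environment R m, compatible E C ->
    behaviour (interconnection E S) `<=` behaviour (guarantees C).

Definition consistent (R : realType) (m p : nat) (C : contract R m p) : Prop :=
  exists S : system R m p, implements S C.

Definition refines (R : realType) (m p : nat) (C1 C2 : contract R m p) : Prop :=
  (forall E : environment R m, compatible E C2 -> compatible E C1) /\
  (forall S : system R m p, implements S C1 -> implements S C2).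

(* Main.v *)
Require Import Defs.
From mathcomp Require Import ring lra.
From mathcomp Require complex.
Set Implicit Arguments.
Unset Strict Implicit.
Unset Printing Implicit Defensive.
Import Order.TTheory GRing.Theory Num.Theory.
Local Open Scope classical_set_scope.
Local Open Scope ring_scope.

(** Sufficiency of the two inclusions is immediate: a trajectory of an
    implementation of the first contract whose input satisfies [A2] also
    satisfies [A1], hence [G1], hence [G2].  Consistency of the second contract
    is immediate as well, since an implementation of the first implements it.

    For necessity, fix an implementation [P y = Q u] of the first contract, and
    let [L1 y = H1 u] and [L2 y = H2 u] be the equations of the guarantees.
    Implementing a contract is an algebraic condition ([implementsP]): there is
    a polynomial matrix [M1] with [L1 = M1 P], and [H1 u = M1 Q u] for all inputs
    [u] allowed by [A1].  Likewise [L2 = M2 P], and [H2 u = M2 Q u] for the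
    inputs allowed by [A2].  It is enough to show [M2 = Z M1], since then
    [L1 y = H1 u] implies [L2 y = Z L1 y = Z H1 u = M2 Q u = H2 u].

    A single implementation is too small to give this, because all its
    trajectories satisfy [P y = Q u].  But for each invertible [T] such that
    [M1] is a left multiple of [T], the larger system [T P y = T Q u] has the
    same transfer matrix and still implements the first contract.  Hence it
    implements the second, and [M2] is a left multiple of [T] as well.  Choosing
    for [T] a square basis of the row module of [M1] and [c I]
    ([mx_greatest_right_divisor]) gives [M2 = X M1 + c Y], and for a good choice
    of the polynomial [c] this forces [M2] to be a left multiple of [M1]
    ([mx_row_module_modulo], [refines_factor]).

    Behaviours are translated into algebra by two properties of [P(d/dt)] for
    [det P] nonzero: it is onto the smooth signals ([mxdiffop_surjective]), and
    a matrix operator vanishing on its kernel is a left multiple of it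
    ([mxdiffop_ker_factor]).  Multiplication by the adjugate matrix reduces both
    to scalar operators, where they hold for linear and quadratic
    polynomials by variation of constants and pass to products
    ([regular_operator_neq0]). *)

(** * Polynomial matrices *)

Section PolynomialMatrices.

Lemma tofrac_denominator (D : idomainType) (x : {fraction D}) :
  exists2 c : D, c != 0 & exists a : D, tofrac c * x = tofrac a.
Proof.
elim/quotW: x => x; exists (frac x).2; first exact: denom_ratioP.
exists (frac x).1; rewrite -[LHS]/(FracField.mul _ _) !piE.
apply/eqmodP; rewrite /= FracField.equivfE /FracField.mulf.
by rewrite !numden_Ratio ?mul1r ?oner_neq0 ?denom_ratioP// mulr1 mulrC.
Qed.

Lemma tofrac_denominators (D : idomainType) (I : finType)
    (x : I -> {fraction D}) :
  exists2 c : D, c != 0 & forall i, exists a : D, tofrac c * x i = tofrac a.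
Proof.
suff [c c0 cP] : exists2 c : D, c != 0 &
    forall i, i \in enum I -> exists a : D, tofrac c * x i = tofrac a.
  by exists c => // i; apply: cP; rewrite mem_enum.
elim: (enum I) => [|j s [c c0 cP]]; first by exists 1; rewrite ?oner_eq0.
have [d d0 [b bP]] := tofrac_denominator (x j).
exists (d * c) => [|i]; first by rewrite mulf_neq0.
rewrite inE => /predU1P[->|/cP[a aP]].
  by exists (c * b); rewrite [d * c]mulrC !tofracM -mulrA bP.
by exists (d * a); rewrite !tofracM -mulrA aP.
Qed.

Lemma map_tofrac_inj (D : idomainType) r n :
  injective (fun M : 'M[D]_(r, n) => map_mx (@tofrac D) M).
Proof.
move=> A B /matrixP AB; apply/matrixP => i j.
by have /eqP := AB i j; rewrite !mxE tofrac_eq => /eqP.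
Qed.

(** A generalised inverse of [M] over the fraction field, with denominators
    cleared. *)
Lemma mx_pseudo_inverse (D : idomainType) r n (M : 'M[D]_(r, n)) :
  exists2 c : D, c != 0 & exists K : 'M[D]_(n, r), M *m K *m M = c *: M.
Proof.
pose MF := map_mx (@tofrac D) M.
have [c c0 cP] := tofrac_denominators
  (fun ij : 'I_n * 'I_r => pinvmx MF ij.1 ij.2).
have /fin_all_exists[k kP] := cP.
exists c => //; exists (\matrix_(i, j) k (i, j)); set K := \matrix_(i, j) _.
have KE : map_mx (@tofrac D) K = tofrac c *: pinvmx MF.
  by apply/matrixP => i j; rewrite [LHS]mxE [K i j]mxE [RHS]mxE -(kP (i, j)).
apply: map_tofrac_inj; rewrite !map_mxM/= map_mxZ/= KE -scalemxAr -scalemxAl.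
by rewrite mulmxKpV.
Qed.

(** The quotient of [G * adj P] by [det P] is the only candidate for
    [G * P^-1]. *)
Lemma mx_right_factor (F : fieldType) r n (P : 'M[{poly F}]_n)
    (G : 'M[{poly F}]_(r, n)) : \det P != 0 ->
  (forall i j, \det P %| (G *m \adj P) i j) ->
  exists M : 'M[{poly F}]_(r, n), G = M *m P.
Proof.
move=> P0 dvd; pose M := \matrix_(i, j) ((G *m \adj P) i j %/ \det P).
have ME : G *m \adj P = \det P *: M.
  by apply/matrixP => i j; rewrite [RHS]mxE [X in _ * X]mxE mulrC divpK.
exists M; apply: (scalemx_inj P0).
by rewrite scalemxAl -ME -mulmxA mul_adj_mx -scalemx1 -scalemxAr mulmx1.
Qed.

(** The row module of a polynomial matrix of full column rank has a square
    basis.  Take a square [S] with rows in the module and determinant of least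
    degree among the nonzero ones: reducing an entry of [N *m \adj S] modulo
    [\det S] amounts to replacing one row of [S] by a combination of it with a
    row of [N], so by minimality [\det S] divides [N *m \adj S]. *)
Lemma mx_greatest_right_divisor (F : fieldType) r n (N : 'M[{poly F}]_(r, n))
    (S : 'M[{poly F}]_n) (Y : 'M[{poly F}]_(n, r)) :
  S = Y *m N -> \det S != 0 ->
  exists (T : 'M[{poly F}]_n) (X : 'M[{poly F}]_(r, n))
      (Z : 'M[{poly F}]_(n, r)),
    [/\ \det T != 0, N = X *m T & T = Z *m N].
Proof.
have [d] := ubnP (size (\det S)); elim: d S Y => // d IHd S Y Sd SE S0.
have [dvd|] := boolP [forall i, forall j, \det S %| (N *m \adj S) i j].
  have [i j|X NE] := @mx_right_factor _ _ _ _ N S0.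
    by have /forallP/(_ i)/forallP := dvd.
  by exists S, X, Y.
rewrite negb_forall => /existsP[k]; rewrite negb_forall => /existsP[i ndvd].
pose q := (N *m \adj S) k i %/ \det S.
pose S' := \matrix_(a, b) (if a == i then N k b - q * S i b else S a b).
pose Y' := \matrix_(a, b) (if a == i then (b == k)%:R - q * Y i b else Y a b).
have detS' : \det S' = (N *m \adj S) k i %% \det S.
  have cofS' j : cofactor S' i j = cofactor S i j.
    rewrite /cofactor; congr (_ * \det _); apply/matrixP => a b.
    by rewrite !mxE eq_sym (negbTE (neq_lift i a)).
  have -> : (N *m \adj S) k i %% \det S = (N *m \adj S) k i - q * \det S.
    by apply/eqP; rewrite eq_sym subr_eq addrC -divp_eq.
  rewrite (expand_det_row S' i) (expand_det_row S i) mxE mulr_sumr -sumrB.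
  apply: eq_bigr => j _; rewrite cofS' !mxE eqxx; ring.
have S'E : S' = Y' *m N.
  apply/matrixP => a b; rewrite !mxE; have [->|ai] := eqVneq a i.
    under eq_bigr do rewrite mxE eqxx mulrBl.
    rewrite sumrB (bigD1 k)//= eqxx mul1r big1 ?addr0; last first.
      by move=> j /negbTE ->; rewrite mul0r.
    rewrite SE mxE mulr_sumr; congr (_ - _).
    by apply: eq_bigr => j _; rewrite mulrA.
  by rewrite SE mxE; apply: eq_bigr => j _; rewrite mxE (negbTE ai).
apply: (IHd S' Y') => //; last by rewrite detS'.
by rewrite detS' (leq_trans _ (_ : size (\det S) <= d)%N)// ltn_modp.
Qed.

(** For a suitable [c], membership of the rows of [V] in the row module of [M]
    modulo [c] gives membership.  Let [K] be a pseudo-inverse with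
    [M K M = c0 M], and [c] a multiple of [c0] of large degree.  If
    [V = X M + c Y], the defect [V (c0 - K M)] equals [c Y (c0 - K M)], so it
    vanishes for degree reasons; then [c0 Y = Y K M]. *)
Lemma mx_row_module_modulo (F : fieldType) r k n (M : 'M[{poly F}]_(r, n))
    (V : 'M[{poly F}]_(k, n)) :
  exists2 c : {poly F}, c != 0 &
    forall X Y, V = X *m M + c *: Y -> exists Z, V = Z *m M.
Proof.
have [c0 c00 [K KP]] := mx_pseudo_inverse M.
pose defect := c0%:M - K *m M.
have Mdefect : M *m defect = 0.
  by rewrite mulmxBr mulmxA KP mul_mx_scalar subrr.
pose d := \max_ij size ((V *m defect) ij.1 ij.2).
exists (c0 * 'X^d) => [|X Y VE].
  by rewrite mulf_neq0// monic_neq0 ?monicXn.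
have VdefectE : V *m defect = (c0 * 'X^d) *: (Y *m defect).
  by rewrite VE mulmxDl -mulmxA Mdefect mulmx0 add0r -scalemxAl.
have Ydefect : Y *m defect = 0.
  apply/matrixP => i j; rewrite [RHS]mxE; apply/eqP; apply: contraT => Y0.
  have : (size ((V *m defect) i j) <= d)%N.
    exact: (@leq_bigmax _ (fun ij => size ((V *m defect) ij.1 ij.2)) (i, j)).
  rewrite VdefectE mxE -mulrA mulrCA mulrC size_mulXn ?mulf_neq0//.
  rewrite -[leqRHS]addn0 leq_add2l leqn0 size_poly_eq0 mulf_eq0.
  by rewrite (negbTE c00) (negbTE Y0).
exists (X + 'X^d *: (Y *m K)); rewrite mulmxDl {1}VE; congr (_ + _).
rewrite mulrC -scalerA -scalemxAl; congr (_ *: _); apply/eqP.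
by rewrite -mulmxA -mul_mx_scalar -subr_eq0 -mulmxBr Ydefect.
Qed.

Lemma mulmx_det_neq0_inj (D : idomainType) r n (P : 'M[D]_n) :
  \det P != 0 -> injective (fun M : 'M[D]_(r, n) => M *m P).
Proof.
move=> P0 M N /= /(congr1 (mulmx^~ (\adj P))).
by rewrite -!mulmxA mul_mx_adj !mul_mx_scalar => /(scalemx_inj P0).
Qed.

Lemma invmx_mulmx_cancel (K : fieldType) n k (A B : 'M[K]_n)
    (C : 'M[K]_(n, k)) :
  A \in unitmx -> B \in unitmx ->
  invmx (A *m B) *m (A *m C) = invmx B *m C.
Proof.
move=> uA uB; have uAB : A *m B \in unitmx by rewrite unitmx_mul uA.
apply: (can_inj (mulKmx uAB)); rewrite mulKVmx//.
by rewrite -mulmxA mulKVmx.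
Qed.

Lemma ratmx_unit (R : realType) n (P : 'M[{poly R}]_n) :
  (ratmx P \in unitmx) = (\det P != 0).
Proof. by rewrite unitmxE det_map_mx unitfE tofrac_eq0. Qed.

End PolynomialMatrices.

(** * Smooth functions and scalar differential operators *)

Section Smooth.
Variable R : realType.
Implicit Types (f g : R -> R) (a b : {poly R}) (k : nat).

Lemma derive1Sn f k : derive1n k.+1 f = derive1n k (derive1 f).
Proof. by rewrite /derive1n iterSr. Qed.

(** The recursion is on the derivative of [f], not on the iterates of
    differentiation: the inductions below for sums and products then only need
    the first-order rules. *)
Fixpoint differentiable_upto k f : Prop :=
  if k is l.+1 then
    (forall t : R, derivable f t 1) /\ differentiable_upto l (derive1 f)
  else True.

Lemma smoothE f : smooth f <-> forall k, differentiable_upto k f.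
Proof.
split=> [sf k|df k t].
  elim: k f sf => [|k IHk] f sf //=; split; first exact: sf 0%N.
  by apply: IHk => l t; rewrite -derive1Sn; exact: sf l.+1 t.
elim: k f df => [|k IHk] f df; first exact: (df 1%N).1.
by rewrite derive1Sn; apply: IHk => l; exact: (df l.+1).2.
Qed.

Lemma smooth_derivable f t : smooth f -> derivable f t 1.
Proof. by move=> sf; exact: (sf 0%N t). Qed.

Lemma smooth_derive f : smooth f -> smooth (derive1 f).
Proof. by move=> sf k t; rewrite -derive1Sn; exact: sf. Qed.

(* Otherwise unification unfolds derivatives down to limits of quotients. *)
#[local] Opaque smooth derive1 derive.

Lemma smooth_derivative f g :
  (forall t : R, is_derive t 1 f (g t)) -> smooth g -> smooth f.
Proof.
move=> dfg sg; have fE : derive1 f = g.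
  by apply/funext => t; rewrite derive1E derive_val.
apply/smoothE => -[|k] //=; split=> [t|]; first by have [] := dfg t.
by rewrite fE; apply: (smoothE g).1.
Qed.

Lemma differentiable_uptoW k f :
  differentiable_upto k.+1 f -> differentiable_upto k f.
Proof.
by elim: k f => [|k IHk] f //= [df dkf]; split=> //; exact: IHk.
Qed.

Lemma derive1_add f g : (forall t : R, derivable f t 1) ->
  (forall t : R, derivable g t 1) -> derive1 (f \+ g) = derive1 f \+ derive1 g.
Proof.
move=> df dg; apply/funext => t; rewrite !derive1E.
by rewrite (deriveD (df t) (dg t)) /= !derive1E.
Qed.

Lemma derive1_mul f g : (forall t : R, derivable f t 1) ->
  (forall t : R, derivable g t 1) ->
  derive1 (f \* g) = (derive1 f \* g) \+ (f \* derive1 g).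
Proof.
move=> df dg; apply/funext => t; rewrite !derive1E.
rewrite (deriveM (df t) (dg t)) /= !derive1E /GRing.scale/= addrC.
by rewrite [g t * _]mulrC.
Qed.

Lemma differentiable_uptoD k f g : differentiable_upto k f ->
  differentiable_upto k g -> differentiable_upto k (f \+ g).
Proof.
elim: k f g => [|k IHk] f g //= [df dkf] [dg dkg]; split.
  by move=> t; exact: derivableD.
by rewrite derive1_add//; exact: IHk.
Qed.

Lemma differentiable_uptoM k f g : differentiable_upto k f ->
  differentiable_upto k g -> differentiable_upto k (f \* g).
Proof.
elim: k f g => [|k IHk] f g // dkf dkg.
have [df dkf'] := dkf; have [dg dkg'] := dkg; split.
  by move=> t; exact: derivableM.
rewrite derive1_mul//; apply: differentiable_uptoD; apply: IHk => //;
  exact: differentiable_uptoW.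
Qed.

Lemma smoothD f g : smooth f -> smooth g -> smooth (f \+ g).
Proof.
move=> /smoothE sf /smoothE sg; apply/smoothE => k.
exact: differentiable_uptoD.
Qed.

Lemma smoothM f g : smooth f -> smooth g -> smooth (f \* g).
Proof.
move=> /smoothE sf /smoothE sg; apply/smoothE => k.
exact: differentiable_uptoM.
Qed.

Lemma smooth_cst (c : R) : smooth (fun=> c).
Proof.
apply/smoothE => k; elim: k c => [|k IHk] c //=; split.
  by move=> t; exact: derivable_cst.
suff -> : derive1 (fun=> c : R) = (fun=> 0) by exact: IHk.
by apply/funext => t; rewrite derive1_cst.
Qed.

Lemma smoothZ (c : R) f : smooth f -> smooth (fun t => c * f t).
Proof. exact (smoothM (@smooth_cst c)). Qed.

Lemma smooth_sum (I : Type) (r : seq I) (F : I -> R -> R) :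
  (forall i, smooth (F i)) -> smooth (fun t => \sum_(i <- r) F i t).
Proof.
move=> sF; elim: r => [|i r IHr].
  by under eq_fun do rewrite big_nil; exact: smooth_cst.
by under eq_fun do rewrite big_cons; exact: (smoothD (sF i) IHr).
Qed.

Lemma derive1nD k f g : smooth f -> smooth g ->
  derive1n k (f \+ g) = derive1n k f \+ derive1n k g.
Proof.
elim: k f g => [|k IHk] f g // sf sg; rewrite !derive1Sn derive1_add.
- by rewrite (IHk _ _ (smooth_derive sf) (smooth_derive sg)).
- by move=> t; exact: smooth_derivable.
- by move=> t; exact: smooth_derivable.
Qed.

Lemma derive1nZ k (c : R) f : smooth f ->
  derive1n k (fun t => c * f t) = (fun t => c * derive1n k f t).
Proof.
elim: k f => [|k IHk] f // sf.
rewrite !derive1Sn -IHk; last exact: smooth_derive.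
congr derive1n; apply/funext => t; rewrite !derive1E.
by rewrite -[LHS]/('D_1 (c \*: f) t) deriveZ//; exact: smooth_derivable.
Qed.

(** Operators given by polynomials of different sizes can be added
    coefficientwise once both are summed over a common range of indices. *)
Lemma diffop_widen n a f t : (size a <= n)%N ->
  diffop a f t = \sum_(k < n) a`_k * derive1n k f t.
Proof.
move=> an; rewrite /diffop (big_ord_widen n (fun k => a`_k * derive1n k f t))//.
rewrite big_mkcond/=; apply: eq_bigr => i _; case: ltnP => // ai.
by rewrite nth_default ?mul0r.
Qed.

Lemma diffopDl a b f t : diffop (a + b) f t = diffop a f t + diffop b f t.
Proof.
pose n := maxn (size a) (size b).
rewrite (@diffop_widen n) ?size_polyD// (@diffop_widen n a) ?leq_maxl//.
rewrite (@diffop_widen n b) ?leq_maxr// -big_split/=.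
by apply: eq_bigr => i _; rewrite coefD mulrDl.
Qed.

Lemma diffopZl (c : R) a f t : diffop (c *: a) f t = c * diffop a f t.
Proof.
rewrite (@diffop_widen (size a)) ?size_scale_leq// /diffop mulr_sumr.
by apply: eq_bigr => i _; rewrite coefZ mulrA.
Qed.

Lemma diffopC (c : R) f t : diffop c%:P f t = c * f t.
Proof.
by rewrite (@diffop_widen 1) ?size_polyC_leq1// big_ord1 coefC.
Qed.

Lemma diffopMX a f t : diffop (a * 'X) f t = diffop a (derive1 f) t.
Proof.
have sz : (size (a * 'X)%R <= (size a).+1)%N.
  by rewrite (leq_trans (size_polyMleq _ _))// size_polyX addn2.
rewrite (diffop_widen _ _ sz) big_ord_recl coefMX mul0r add0r /diffop.
by apply: eq_bigr => i _; rewrite coefMX /= -derive1Sn.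
Qed.

Lemma diffopX f t : diffop 'X f t = (derive1 f) t.
Proof. by rewrite -['X]mul1r diffopMX -[1]/(1%:P) diffopC mul1r. Qed.

Lemma diffop_sum (I : Type) (r : seq I) (F : I -> {poly R}) f t :
  diffop (\sum_(i <- r) F i) f t = \sum_(i <- r) diffop (F i) f t.
Proof.
elim: r => [|i r IHr]; first by rewrite !big_nil diffop0.
by rewrite !big_cons diffopDl IHr.
Qed.

Lemma diffopDr a f g : smooth f -> smooth g ->
  diffop a (f \+ g) = diffop a f \+ diffop a g.
Proof.
move=> sf sg; apply/funext => t; rewrite /= /diffop -big_split/=.
by apply: eq_bigr => i _; rewrite derive1nD// mulrDr.
Qed.

Lemma diffopZr a (c : R) f : smooth f ->
  diffop a (fun t => c * f t) = (fun t => c * diffop a f t).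
Proof.
move=> sf; apply/funext => t; rewrite /diffop mulr_sumr.
by apply: eq_bigr => i _; rewrite derive1nZ// mulrCA.
Qed.

Lemma diffop_fun0 a : diffop a (fun=> 0) = (fun=> 0).
Proof.
have := diffopZr a 0 (@smooth_cst 0).
under [X in diffop a X]eq_fun do rewrite mul0r.
by move=> ->; apply/funext => t; rewrite mul0r.
Qed.

Lemma smooth_derive1n k f : smooth f -> smooth (derive1n k f).
Proof.
elim: k f => [|k IHk] f sf; first exact: sf.
by rewrite derive1Sn; exact: (IHk _ (smooth_derive sf)).
Qed.

Lemma smooth_diffop a f : smooth f -> smooth (diffop a f).
Proof.
by move=> sf; apply: smooth_sum => i; exact/smoothZ/smooth_derive1n.
Qed.

Lemma diffop_sumr (I : Type) (r : seq I) a (F : I -> R -> R) :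
  (forall i, smooth (F i)) ->
  diffop a (fun t => \sum_(i <- r) F i t) =
  (fun t => \sum_(i <- r) diffop a (F i) t).
Proof.
move=> sF; elim: r => [|i r IHr].
  under eq_fun do rewrite big_nil.
  by rewrite diffop_fun0; apply/funext => t; rewrite big_nil.
under eq_fun do rewrite big_cons.
rewrite (diffopDr a (sF i) (smooth_sum sF)) IHr.
by apply/funext => t; rewrite big_cons.
Qed.

(** Composition of operators is multiplication of polynomials, so the constant
    coefficient operators form a commutative algebra acting on smooth
    functions. *)
Lemma diffopM a b f : smooth f -> diffop (a * b) f = diffop a (diffop b f).
Proof.
elim/poly_ind: b f => [|b c IHb] f sf.
  rewrite mulr0 (_ : diffop 0 f = fun=> 0) ?diffop_fun0//.
  by apply/funext => t; rewrite diffop0.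
have -> : diffop (b * 'X + c%:P) f = diffop b (derive1 f) \+ (fun t => c * f t).
  by apply/funext => t; rewrite diffopDl diffopMX diffopC.
have sf' := smooth_derive sf.
rewrite diffopDr; [|exact: smooth_diffop|exact: smoothZ].
rewrite -IHb// diffopZr//; apply/funext => t /=.
by rewrite mulrDr diffopDl mulrA diffopMX [a * c%:P]mulrC mul_polyC diffopZl.
Qed.

End Smooth.

(** * Primitives on the whole line *)

Section Primitive.
Variable R : realType.
Implicit Types f g : R -> R.
Notation mu := (@lebesgue_measure R).

(** The base point of the integral depends on the argument, moving left of it:
    an indefinite integral from a fixed base point is a primitive only to the
    right of that point.  Subtracting the value at [0] makes the result
    independent of the base point. *)
Lemma primitive_exists f : continuous f ->
  exists F : R -> R, forall t : R, is_derive t 1 F (f t).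
Proof.
move=> cf; have intf (a b : R) : mu.-integrable `[a, b]%classic (EFin \o f).
  apply: continuous_compact_integrable; first exact: segment_compact.
  exact: continuous_subspaceT.
pose G a t : R := (\int[mu]_(s in `[a, t]%classic) f s)%R.
have Gchasles a b t : a <= b -> b <= t -> G a t = G a b + G b t.
  move=> ab bt; apply/eqP; rewrite addrC -subr_eq; apply/eqP.
  rewrite /G -[RHS]Rintegral_itv_obnd_cbnd.
    by rewrite Rintegral_itvB ?bnd_simp.
  by apply: integrableS (intf b t) => //; apply: subset_itvr; rewrite bnd_simp.
exists (fun t => G (- `|t| - 1) t - G (- `|t| - 1) 0) => t.
pose a := - `|t| - 2.
have at_ : a < t.
  by have := ler_norm (- t); rewrite normrN /a; lra.
have nt : \forall s \near nbhs t,
    G a s - G a 0 = G (- `|s| - 1) s - G (- `|s| - 1) 0.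
  have : \forall s \near nbhs t, `|s - t| < 1.
    by exists 1 => //= s; rewrite distrC.
  apply: filterS => s st.
  have asb : a <= - `|s| - 1.
    have := ler_normD (s - t) t; rewrite subrK /a; lra.
  rewrite (Gchasles a (- `|s| - 1) s)//; last first.
    by have := ler_norm (- s); rewrite normrN; lra.
  rewrite (Gchasles a (- `|s| - 1) 0)//; lra.
apply: near_eq_is_derive nt _.
have [dG GE] := @continuous_FTC1_closed R f a t (t + 1)
  (ltr_pwDr ltr01 (lexx t)) (intf _ _) at_ (cf t).
rewrite -GE -[X in is_derive _ _ _ X]subr0; apply: is_deriveB.
by rewrite derive1E; apply/derivableP.
Qed.

End Primitive.

(** * Real factors of real polynomials *)

Section Factor.

Lemma size_le2_poly (R : nzRingType) (r : {poly R}) :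
  (size r <= 2)%N -> r = r`_1 *: 'X + (r`_0)%:P.
Proof.
move=> sr; apply/polyP => i; rewrite coefD coefZ coefX coefC.
case: i => [|[|i]]; rewrite ?mulr0 ?mulr1 ?add0r ?addr0//.
by rewrite nth_default// (leq_trans sr).
Qed.

Lemma size_quadratic (R : idomainType) (a b : R) :
  size (('X - a%:P) ^+ 2 + (b ^+ 2)%:P) = 3%N.
Proof.
rewrite size_polyDl size_exp_XsubC//.
by rewrite (leq_ltn_trans (size_polyC_leq1 _)).
Qed.

Import complex.

(** A complex root [a + ib] of [p] makes [X - a] or [(X - a)^2 + b^2] divide
    [p], according to whether [b] vanishes. *)
Lemma real_poly_factor (R : rcfType) (p : {poly R}) : (size p != 1)%N ->
  exists a b : R,
    ('X - a%:P) %| p \/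
    (b != 0 /\ (('X - a%:P) ^+ 2 + (b ^+ 2)%:P) %| p).
Proof.
move=> sp.
have [|z] := @closed_rootP _ (map_poly (real_complex R) p) _.
  by rewrite size_map_poly.
case: z => a b rz; exists a, b; have [b0|b0] := eqVneq b 0.
  left; rewrite dvdp_XsubCl; move: rz; rewrite b0.
  by rewrite -[Complex _ _]/(real_complex R a) fmorph_root.
right; split=> //; set l := _ + _.
have lz : (map_poly (real_complex R) l).[Complex a b] = 0.
  rewrite rmorphD rmorphXn/= rmorphB/= map_polyX !map_polyC/= !hornerE.
  apply/eqP; rewrite eq_complex /= !expr2/=.
  by apply/andP; split; apply/eqP; ring.
have sr : (size (p %% l)%R <= 2)%N.
  by rewrite -ltnS -(size_quadratic a b) ltn_modp -size_poly_eq0 size_quadratic.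
have := rz; rewrite {1}(divp_eq p l) rmorphD rmorphM/= rootE hornerD hornerM lz.
rewrite mulr0 add0r /dvdp; move: (size_le2_poly sr); set r := p %% l => rE.
rewrite rE -mul_polyC rmorphD rmorphM/= map_polyX !map_polyC/= !hornerE.
rewrite eq_complex /= => /andP[r0 r1].
have r1E : r`_1 = 0.
  apply/eqP; rewrite -(mulIr_eq0 _ (mulIf b0)).
  by move: r1; rewrite mul0r !addr0.
move: r0; rewrite r1E !mul0r subr0 add0r => /eqP r0E.
by rewrite r0E polyC0 add0r.
Qed.

End Factor.

(** * Surjectivity and kernels of scalar operators *)

Section ScalarOperators.
Variable R : realType.
Implicit Types (f g z : R -> R) (a b l : {poly R}).

(** The real and imaginary parts of [e^((al + i be) t)]; with [be = 0] the first
    is also the exponential used for real roots. *)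
Definition expcos (al be : R) : R -> R :=
  fun t => expR (al * t) * cos (be * t).
Definition expsin (al be : R) : R -> R :=
  fun t => expR (al * t) * sin (be * t).

Lemma is_derive_mull (c t : R) : is_derive t 1 (fun s : R => c * s) c.
Proof.
have := is_deriveZ c (is_derive_id t (1 : R)).
by rewrite /GRing.scale/= mulr1.
Qed.

Lemma is_derive_comp_mull (g : R -> R) (c t dg : R) :
  is_derive (c * t) 1 g dg -> is_derive t 1 (fun s : R => g (c * s)) (c * dg).
Proof.
move=> dgE; apply: is_derive_eq (is_derive1_comp dgE (is_derive_mull c t)) _.
by rewrite mulrC.
Qed.

Lemma is_derive_expcos al be (t : R) :
  is_derive t 1 (expcos al be) (al * expcos al be t - be * expsin al be t).
Proof.
apply: is_derive_eq (is_deriveM (is_derive_comp_mull (is_derive_expR (al * t)))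
  (is_derive_comp_mull (is_derive_cos (be * t)))) _.
rewrite /GRing.scale/= /expcos /expsin; ring.
Qed.

Lemma is_derive_expsin al be (t : R) :
  is_derive t 1 (expsin al be) (al * expsin al be t + be * expcos al be t).
Proof.
apply: is_derive_eq (is_deriveM (is_derive_comp_mull (is_derive_expR (al * t)))
  (is_derive_comp_mull (is_derive_sin (be * t)))) _.
rewrite /GRing.scale/= /expcos /expsin; ring.
Qed.

Lemma is_derive_derive1 f g : (forall t : R, is_derive t 1 f (g t)) ->
  derive1 f = g.
Proof. by move=> dfg; apply/funext => t; rewrite derive1E derive_val. Qed.

Lemma expcos_expsin_smooth al be :
  smooth (expcos al be) /\ smooth (expsin al be).
Proof.
have [dc ds] := (is_derive_derive1 (is_derive_expcos al be),
                 is_derive_derive1 (is_derive_expsin al be)).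
have cstU k (c : R) f : differentiable_upto k f ->
    differentiable_upto k (fun t => c * f t).
  move=> df; apply: (differentiable_uptoM _ df).
  exact: (smoothE _).1 (@smooth_cst R c) k.
suff cs k : differentiable_upto k (expcos al be) /\
            differentiable_upto k (expsin al be).
  by split; apply/smoothE => k; have [] := cs k.
elim: k => [|k [IHc IHs]] //=; rewrite dc ds; split; split.
- by move=> t; have [] := is_derive_expcos al be t.
- under eq_fun do rewrite -mulNr.
  by apply: differentiable_uptoD; exact: cstU.
- by move=> t; have [] := is_derive_expsin al be t.
- by apply: differentiable_uptoD; exact: cstU.
Qed.

Lemma expcos0 al be : expcos al be 0 = 1.
Proof. by rewrite /expcos !mulr0 expR0 cos0 mulr1. Qed.

Lemma expsin0 al be : expsin al be 0 = 0.
Proof. by rewrite /expsin !mulr0 sin0 mulr0. Qed.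

Lemma diffopXsubC (c : R) f g : (forall t : R, is_derive t 1 f (g t)) ->
  diffop ('X - c%:P) f = (fun t => g t - c * f t).
Proof.
move=> dfg; apply/funext => t.
by rewrite -rmorphN/= diffopDl diffopX diffopC mulNr (is_derive_derive1 dfg).
Qed.

Lemma smooth_primitive f : smooth f ->
  exists F : R -> R, forall t : R, is_derive t 1 F (f t).
Proof.
move=> sf; apply: primitive_exists => t.
exact/differentiable_continuous/derivable1_diffP/smooth_derivable.
Qed.

(** The two halves are carried along together because the kernel criterion for
    a product uses surjectivity of one of its factors. *)
Definition regular_operator a : Prop :=
  (forall f, smooth f -> exists2 y, smooth y & diffop a y = f) /\
  (forall b, (forall z, smooth z -> diffop a z = (fun=> 0) ->
                diffop b z = (fun=> 0)) -> a %| b).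

Lemma regular_operatorC (c : R) : c != 0 -> regular_operator c%:P.
Proof.
move=> c0; split=> [f sf|b _].
  exists (fun t => c^-1 * f t); first exact: smoothZ.
  by apply/funext => t; rewrite diffopC mulVKf.
have c1 : c%:P %= 1 by rewrite polyC_eqp1.
by rewrite (eqp_dvdl _ c1) dvd1p.
Qed.

(** If [a b] has its kernel inside that of [d], then so has [b], and [d = q b].
    A solution [z] of [a z = 0] is of the form [b w], because [b] is onto,
    whence [q z = d w = 0]; thus [a] divides [q]. *)
Lemma regular_operatorM a b :
  regular_operator a -> regular_operator b -> regular_operator (a * b).
Proof.
move=> [sa ka] [sb kb]; split=> [f /sa[g /sb[y sy <-] <-]|d kd].
  by exists y => //; exact: diffopM.
have /dvdpP[q dE] : b %| d.
  apply: kb => z sz bz; apply: kd => //.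
  by rewrite diffopM// bz diffop_fun0.
rewrite dE dvdp_mul//; apply: ka => z /sb[w sw zE]; rewrite -zE => aw.
by rewrite -diffopM// -dE; apply: kd => //; rewrite diffopM.
Qed.

Lemma diffop_modp l b z : smooth z -> diffop l z = (fun=> 0) ->
  diffop (b %% l) z = diffop b z.
Proof.
move=> sz lz; rewrite {2}(divp_eq b l); apply/funext => t.
by rewrite diffopDl diffopM// lz diffop_fun0 add0r.
Qed.

(** Variation of constants: [y = e^(ct) F] with [F] a primitive of
    [e^(-ct) f]. *)
Lemma regular_operator_XsubC (c : R) : regular_operator ('X - c%:P).
Proof.
have [sE _] := expcos_expsin_smooth c 0.
have dE t := is_derive_expcos c 0 t.
split=> [f sf|b kb].
  have [sE' _] := expcos_expsin_smooth (- c) 0.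
  have [F dF] := smooth_primitive (smoothM sE' sf).
  have sF := smooth_derivative dF (smoothM sE' sf).
  pose y t := expcos c 0 t * F t.
  have expK t : expcos c 0 t * expcos (- c) 0 t = 1.
    by rewrite /expcos mul0r cos0 !mulr1 -expRD -mulrDl subrr mul0r expR0.
  have dy (t : R) : is_derive t 1 y (c * y t + f t).
    apply: is_derive_eq (is_deriveM (dE t) (dF t)) _.
    rewrite /y /GRing.scale/= -[in RHS](mul1r (f t)) -(expK t); ring.
  exists y; first exact: smoothM.
  by rewrite (diffopXsubC _ dy); apply/funext => t; rewrite addrAC subrr add0r.
rewrite /dvdp; have /(congr1 (fun h => h 0)) :
    diffop (b %% ('X - c%:P)) (expcos c 0) = fun=> 0.
  have lE : diffop ('X - c%:P) (expcos c 0) = fun=> 0.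
    rewrite (diffopXsubC _ dE); apply/funext => t; ring.
  by rewrite diffop_modp//; exact: kb.
have /size1_polyC -> : (size (b %% ('X - c%:P))%R <= 1)%N.
  by have := ltn_modp b ('X - c%:P); rewrite polyXsubC_eq0 size_XsubC ltnS.
by rewrite diffopC expcos0 mulr1 => ->; rewrite polyC0.
Qed.

(** Variation of constants again, with the real and imaginary parts of
    [e^((al + i be) t)] as fundamental solutions.  In the existence half,
    [w] is [(d/dt - al) y].  In the kernel half, the remainder of [b] modulo the
    quadratic has degree at most one and kills both fundamental solutions; their
    values and derivatives at [0] make it vanish. *)
Lemma regular_operator_quadratic (al be : R) : be != 0 ->
  regular_operator (('X - al%:P) ^+ 2 + (be ^+ 2)%:P).
Proof.
move=> be0; have [sc ss] := expcos_expsin_smooth al be.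
have dc t := is_derive_expcos al be t; have ds t := is_derive_expsin al be t.
have lE z z1 z2 : smooth z ->
    (forall t : R, is_derive t 1 z (al * z t + z1 t)) ->
    (forall t : R, is_derive t 1 z1 (al * z1 t + z2 t)) ->
    diffop (('X - al%:P) ^+ 2 + (be ^+ 2)%:P) z =
    (fun t => z2 t + be ^+ 2 * z t).
  move=> sz dz dz1; have dzE : diffop ('X - al%:P) z = z1.
    rewrite (diffopXsubC _ dz); apply/funext => t.
    by rewrite addrAC subrr add0r.
  apply/funext => t; rewrite diffopDl diffopC expr2 diffopM// dzE.
  by rewrite (diffopXsubC _ dz1); ring.
split=> [f sf|b kb].
  have [sc' ss'] := expcos_expsin_smooth (- al) be.
  have [C dC] := smooth_primitive (smoothM sc' sf).
  have [S dS] := smooth_primitive (smoothM ss' sf).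
  have sC := smooth_derivative dC (smoothM sc' sf).
  have sS := smooth_derivative dS (smoothM ss' sf).
  pose y t := be^-1 * (expsin al be t * C t - expcos al be t * S t).
  pose w t := expcos al be t * C t + expsin al be t * S t.
  have wronskian t : expcos al be t * expcos (- al) be t +
      expsin al be t * expsin (- al) be t = 1.
    rewrite /expcos /expsin.
    transitivity (expR (al * t) * expR (- al * t) *
      (cos (be * t) ^+ 2 + sin (be * t) ^+ 2)); first ring.
    by rewrite cos2Dsin2 -expRD -mulrDl subrr mul0r expR0 mulr1.
  have cross t : expsin al be t * expcos (- al) be t =
      expcos al be t * expsin (- al) be t.
    by rewrite /expcos /expsin; ring.
  have dy (t : R) : is_derive t 1 y (al * y t + w t).
    apply: is_derive_eq (is_deriveZ _ (is_deriveB (is_deriveM (ds t) (dC t))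
      (is_deriveM (dc t) (dS t)))) _.
    rewrite /y /w /GRing.scale/=.
    transitivity (be^-1 * (expsin al be t * expcos (- al) be t * f t
        - expcos al be t * expsin (- al) be t * f t) +
      (al * y t + be^-1 * be * w t)); first by rewrite /y /w; ring.
    by rewrite cross subrr mulr0 add0r mulVf// mul1r.
  have dw (t : R) : is_derive t 1 w (al * w t + (f t - be ^+ 2 * y t)).
    apply: is_derive_eq (is_deriveD (is_deriveM (dc t) (dC t))
      (is_deriveM (ds t) (dS t))) _.
    rewrite /y /w /GRing.scale/=.
    transitivity (al * w t + ((expcos al be t * expcos (- al) be t +
        expsin al be t * expsin (- al) be t) * f t -
      be * (expsin al be t * C t - expcos al be t * S t))).
      by rewrite /w; ring.
    by rewrite wronskian mul1r expr2 -mulrA mulVKf.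
  have sy : smooth y.
    apply: smoothZ; apply: smoothD; first exact: smoothM.
    under eq_fun do rewrite -mulN1r.
    by apply: smoothZ; exact: smoothM.
  exists y => //; rewrite (lE _ _ _ sy dy dw).
  by apply/funext => t; rewrite subrK.
set l := _ + _ in lE kb *.
have ls : diffop l (expsin al be) = fun=> 0.
  have d1 (t : R) : is_derive t 1 (expsin al be)
    (al * expsin al be t + be * expcos al be t) by exact: ds.
  have d2 (t : R) : is_derive t 1 (fun t => be * expcos al be t)
      (al * (be * expcos al be t) + - (be ^+ 2 * expsin al be t)).
    apply: is_derive_eq (is_deriveZ be (dc t)) _.
    by rewrite /GRing.scale/=; ring.
  rewrite (lE _ (fun t => be * expcos al be t)
    (fun t => - (be ^+ 2 * expsin al be t)) ss d1 d2).
  by apply/funext => t; rewrite addNr.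
have lc : diffop l (expcos al be) = fun=> 0.
  have d1 (t : R) : is_derive t 1 (expcos al be)
    (al * expcos al be t + - be * expsin al be t) by rewrite mulNr; exact: dc.
  have d2 (t : R) : is_derive t 1 (fun t => - be * expsin al be t)
      (al * (- be * expsin al be t) + - (be ^+ 2 * expcos al be t)).
    apply: is_derive_eq (is_deriveZ (- be) (ds t)) _.
    by rewrite /GRing.scale/=; ring.
  rewrite (lE _ (fun t => - be * expsin al be t)
    (fun t => - (be ^+ 2 * expcos al be t)) sc d1 d2).
  by apply/funext => t; rewrite addNr.
have rs : diffop (b %% l) (expsin al be) 0 = 0 by rewrite diffop_modp// kb.
have rc : diffop (b %% l) (expcos al be) 0 = 0 by rewrite diffop_modp// kb.
have sr : (size (b %% l)%R <= 2)%N.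
  rewrite -ltnS -(size_quadratic al be) ltn_modp -size_poly_eq0.
  by rewrite size_quadratic.
rewrite /dvdp; move: rs rc; rewrite (size_le2_poly sr).
rewrite !diffopDl !diffopZl !diffopC !diffopX.
rewrite (is_derive_derive1 dc) (is_derive_derive1 ds) !expcos0 !expsin0.
rewrite !(mulr0, mulr1, add0r, addr0, subr0) => /eqP.
rewrite mulf_eq0 (negbTE be0) orbF => /eqP r1; rewrite r1 mul0r add0r => ->.
by rewrite scale0r add0r polyC0.
Qed.

Lemma regular_operator_neq0 a : a != 0 -> regular_operator a.
Proof.
have [n] := ubnP (size a); elim: n a => // n IHn a an a0.
have [a1|a1] := eqVneq (size a) 1%N.
  by have /size_poly1P[c c0 ->] := introT eqP a1; exact: regular_operatorC.
have [al [be alt]] := real_poly_factor a1.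
have [l [l1 la rl]] : exists l,
    [/\ (1 < size l)%N, l %| a & regular_operator l].
  case: alt => [la|[be0 la]].
    exists ('X - al%:P); rewrite size_XsubC.
    by split=> //; exact: regular_operator_XsubC.
  eexists; split; [|exact: la|exact: regular_operator_quadratic].
  by rewrite size_quadratic.
have /dvdpP[q aE] := la.
move: a0 an; rewrite aE mulf_eq0 negb_or => /andP[q0 l0].
rewrite size_mul// => an; apply: regular_operatorM => //; apply: IHn => //.
move: l1 an; case: (size l) => [|[|k]]//= _.
by rewrite !addnS /= => /(leq_ltn_trans (leq_addr _ _)).
Qed.

End ScalarOperators.

(** * Matrix differential operators *)

Section MatrixOperators.
Variable R : realType.

Lemma smooth_mxdiffop r n (M : 'M[{poly R}]_(r, n)) (w : R -> 'cV[R]_n) :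
  smooth_signal w -> smooth_signal (mxdiffop M w).
Proof.
move=> sw i; rewrite /mxdiffop; under eq_fun do rewrite mxE.
by apply: smooth_sum => j; exact: smooth_diffop.
Qed.

Lemma mxdiffopM r n k (M : 'M[{poly R}]_(r, n)) (N : 'M[{poly R}]_(n, k))
    (w : R -> 'cV[R]_k) : smooth_signal w ->
  mxdiffop (M *m N) w = mxdiffop M (mxdiffop N w).
Proof.
move=> sw; apply/funext => t; apply/colP => i; rewrite !mxE.
under eq_bigr do rewrite mxE diffop_sum.
rewrite exchange_big /=; apply: eq_bigr => j _; rewrite /mxdiffop.
under [X in diffop _ X]eq_fun do rewrite mxE.
rewrite diffop_sumr => [|l]; last exact: smooth_diffop.
by apply: eq_bigr => l _; rewrite diffopM.
Qed.

Lemma mxdiffop_signal0 r n (M : 'M[{poly R}]_(r, n)) :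
  mxdiffop M (fun=> 0) = (fun=> 0).
Proof.
apply/funext => t; apply/colP => i; rewrite !mxE big1// => j _.
by under [X in diffop _ X]eq_fun do rewrite mxE; rewrite diffop_fun0.
Qed.

Lemma smooth_signal0 n : smooth_signal (fun=> 0 : 'cV[R]_n).
Proof. by move=> i; under eq_fun do rewrite mxE; exact: smooth_cst. Qed.

Lemma mxdiffop_scalar n (c : {poly R}) (w : R -> 'cV[R]_n) :
  mxdiffop c%:M w = (fun t => \col_i diffop c (fun s => w s i ord0) t).
Proof.
apply/funext => t; apply/colP => i; rewrite !mxE (bigD1 i)//= big1 ?addr0.
  by rewrite mxE eqxx mulr1n.
by move=> j /negbTE ji; rewrite mxE eq_sym ji mulr0n diffop0.
Qed.

(** Solve [det P z = f] componentwise; then [adj P z] works, since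
    [P * adj P] is [det P] times the identity. *)
Lemma mxdiffop_surjective n (P : 'M[{poly R}]_n) (f : R -> 'cV[R]_n) :
  \det P != 0 -> smooth_signal f ->
  exists2 y, smooth_signal y & mxdiffop P y = f.
Proof.
move=> P0 sf; have [surj _] := regular_operator_neq0 P0.
have /fin_all_exists[z zP] : forall i, exists z, smooth z /\
    diffop (\det P) z = (fun t => f t i ord0).
  by move=> i; have [z sz zE] := surj _ (sf i); exists z.
pose Z t : 'cV[R]_n := \col_i z i t.
have sZ : smooth_signal Z.
  by move=> i; under eq_fun do rewrite mxE; exact: (zP i).1.
exists (mxdiffop (\adj P) Z); first exact: smooth_mxdiffop.
rewrite -mxdiffopM// mul_mx_adj mxdiffop_scalar.
apply/funext => t; apply/colP => i; rewrite mxE.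
by under [X in diffop _ X]eq_fun do rewrite mxE; rewrite (zP i).2.
Qed.

(** If [det P z = 0] then [P] kills [adj P] applied to [z], hence so does [G];
    entrywise, [det P] divides [G * adj P]. *)
Lemma mxdiffop_ker_factor r n (P : 'M[{poly R}]_n) (G : 'M[{poly R}]_(r, n)) :
  \det P != 0 ->
  (forall y, smooth_signal y -> mxdiffop P y = (fun=> 0) ->
     mxdiffop G y = (fun=> 0)) ->
  exists M : 'M[{poly R}]_(r, n), G = M *m P.
Proof.
move=> P0 kerPG; have [_ ker] := regular_operator_neq0 P0.
have dvd i j : \det P %| (G *m \adj P) i j.
  apply: ker => z sz dz; pose Z t : 'cV[R]_n := z t *: delta_mx j ord0.
  have ZE k : (fun t => Z t k ord0) = (fun t => (k == j)%:R * z t).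
    by apply/funext => t; rewrite !mxE eqxx andbT mulrC.
  have sZ : smooth_signal Z by move=> k; rewrite ZE; exact: smoothZ.
  have : mxdiffop (G *m \adj P) Z = fun=> 0.
    rewrite mxdiffopM//; apply: kerPG; first exact: smooth_mxdiffop.
    rewrite -mxdiffopM// mul_mx_adj mxdiffop_scalar.
    apply/funext => t; apply/colP => k; rewrite !mxE ZE diffopZr// dz mulr0//.
  move=> h; apply/funext => t.
  have := congr1 (fun g : R -> 'cV[R]_r => g t i ord0) h.
  rewrite /= [LHS]mxE [RHS]mxE => <-.
  rewrite [RHS](bigD1 j)//= [X in _ = _ + X]big1 ?addr0 => [|k /negbTE kj].
    by rewrite ZE eqxx diffopZr//= mul1r.
  by rewrite ZE kj diffopZr// mul0r.
exact: mx_right_factor.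
Qed.

End MatrixOperators.

(** * Contracts *)

Section Contracts.
Variables (R : realType) (m p : nat).
Implicit Types (A E : environment R m) (G : system R m p).
Implicit Types (P : 'M[{poly R}]_p) (Q : 'M[{poly R}]_(p, m)).

Lemma input_output_formP P Q : input_output_form (System P Q) ->
  \det P != 0 /\ proper_mx (invmx (ratmx P) *m ratmx Q).
Proof.
move=> [P' [Q' [eqS uP prop]]].
have eP : P = P' by case: eqS => + _; exact: eq_from_Tagged.
have eQ : Q = Q' by case: eqS => _; exact: eq_from_Tagged.
by rewrite eP eQ -ratmx_unit.
Qed.

Lemma input_behaviour0 A : input_behaviour A (fun=> 0).
Proof. by split; [exact: smooth_signal0|exact: mxdiffop_signal0]. Qed.

(** The guarantees must follow from the equation [P y = Q u] by one and the
    same left multiplication.  That [lhs_mx G] factors through [P] is seen on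
    the trajectories with [u = 0]; the condition on [rhs_mx G] then uses that
    every input is accepted, i.e. that [P y = Q u] is solvable in [y]. *)
Lemma implementsP P Q A G : input_output_form (System P Q) ->
  implements (System P Q) (Contract A G) <->
  exists M : 'M[{poly R}]_(sys_rows G, p), lhs_mx G = M *m P /\
    forall u, input_behaviour A u ->
      mxdiffop (rhs_mx G) u = mxdiffop (M *m Q) u.
Proof.
move=> io; split=> [[_ impl]|[M [GE HE]]]; last first.
  split=> // E compE [u y]; rewrite behaviour_interconnection.
  move=> [[/= su sy PQ] Eu]; split=> //=.
  by rewrite GE (HE _ (compE _ Eu)) !mxdiffopM// PQ.
have [P0 _] := input_output_formP io.
have {}impl u y : input_behaviour A u -> smooth_signal y ->
    mxdiffop P y = mxdiffop Q u ->
    mxdiffop (lhs_mx G) y = mxdiffop (rhs_mx G) u.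
  move=> Au sy PQ; have := impl A (fun _ => id) (u, y).
  rewrite behaviour_interconnection => /(_ _)[|//].
  by split=> //; split=> //; case: Au.
have [M ME] : exists M : 'M[{poly R}]_(sys_rows G, p), lhs_mx G = M *m P.
  apply: mxdiffop_ker_factor => // y sy Py.
  by rewrite (impl _ _ (input_behaviour0 A))// mxdiffop_signal0.
exists M; split=> // u Au.
have [y sy yE] := mxdiffop_surjective P0 (smooth_mxdiffop (M := Q) Au.1).
by rewrite -(impl _ _ Au sy yE) ME !mxdiffopM//; [rewrite yE|exact: Au.1].
Qed.

(** Multiplying both sides by [T] on the left leaves the transfer matrix
    unchanged. *)
Lemma input_output_form_mull P Q (T : 'M[{poly R}]_p) : \det T != 0 ->
  input_output_form (System P Q) ->
  input_output_form (System (T *m P) (T *m Q)).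
Proof.
move=> T0 /input_output_formP[P0 prop]; exists (T *m P), (T *m Q).
have uT : ratmx T \in unitmx by rewrite ratmx_unit.
have uP : ratmx P \in unitmx by rewrite ratmx_unit.
have uTP : ratmx T *m ratmx P \in unitmx by rewrite unitmx_mul uT.
have ratM k (N : 'M[{poly R}]_(p, k)) : ratmx (T *m N) = ratmx T *m ratmx N.
  exact: map_mxM.
split; [by []|by rewrite ratM|rewrite !ratM].
rewrite (invmx_mulmx_cancel _ uT uP); exact: prop.
Qed.

(** Let [M1] and [M2] witness that [P y = Q u] implements the first and the
    second contract.  If [M1] is a left multiple of [T], then [T P y = T Q u]
    still implements the first contract, hence the second, so [M2] is a left
    multiple of [T] too.  A basis [T] of the row module generated by [M1] and
    [c I] is of this kind and gives [M2 = X M1 + c Y]; the term [c I] is there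
    to make this module of full rank, so that [T] is square and invertible. *)
Lemma refines_factor A1 A2 G1 G2 P Q :
  refines (Contract A1 G1) (Contract A2 G2) ->
  implements (System P Q) (Contract A1 G1) ->
  exists (M1 : 'M[{poly R}]_(sys_rows G1, p))
      (Z : 'M[{poly R}]_(sys_rows G2, sys_rows G1)),
    [/\ lhs_mx G1 = M1 *m P, lhs_mx G2 = Z *m M1 *m P,
      forall u, input_behaviour A1 u ->
        mxdiffop (rhs_mx G1) u = mxdiffop (M1 *m Q) u &
      forall u, input_behaviour A2 u ->
        mxdiffop (rhs_mx G2) u = mxdiffop (Z *m M1 *m Q) u].
Proof.
move=> [_ ref] impl1; have io := impl1.1.
have [P0 _] := input_output_formP io.
have [M1 [G1E H1E]] := (implementsP _ _ io).1 impl1.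
have [M2 [G2E H2E]] := (implementsP _ _ io).1 (ref _ impl1).
have [c c0 cP] := mx_row_module_modulo M1 M2.
suff [Z ZE] : exists Z, M2 = Z *m M1 by exists M1, Z; rewrite -ZE.
have cI : c%:M = row_mx 0 1%:M *m col_mx M1 c%:M :> 'M[{poly R}]_p.
  by rewrite mul_row_col mul0mx add0r mul1mx.
have detc : \det (c%:M : 'M[{poly R}]_p) != 0 by rewrite det_scalar expf_neq0.
have [T [X [W [T0 NE TE]]]] := mx_greatest_right_divisor cI detc.
have ioT := input_output_form_mull T0 io.
have M1E : M1 = usubmx X *m T.
  by rewrite -[LHS](col_mxKu M1 c%:M) NE mul_usub_mx.
have implT : implements (System (T *m P) (T *m Q)) (Contract A1 G1).
  apply/(implementsP _ _ ioT); exists (usubmx X); rewrite !mulmxA -M1E.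
  by split.
have [V [VE _]] := (implementsP _ _ ioT).1 (ref _ implT).
have M2E : M2 = V *m T.
  by apply: (mulmx_det_neq0_inj P0); rewrite -G2E VE mulmxA.
apply: (cP (V *m lsubmx W) (V *m rsubmx W)).
rewrite M2E TE -{1}(hsubmxK W) mul_row_col mulmxDr mulmxA mul_mx_scalar.
by rewrite -scalemxAr.
Qed.

End Contracts.

Theorem theorem4 (R : realType) (m p : nat)
    (A1 A2 : environment R m) (G1 G2 : system R m p)
    (C1_consistent : consistent (Contract A1 G1)) :
  (refines (Contract A1 G1) (Contract A2 G2) <->
     (input_behaviour A2 `<=` input_behaviour A1 /\
      behaviour (interconnection A2 G1) `<=` behaviour G2)) /\
  (refines (Contract A1 G1) (Contract A2 G2) -> consistent (Contract A2 G2)).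
Proof.
have [S implS] := C1_consistent.
split; last by move=> [_ ref]; exists S; exact: ref.
split=> [ref|[A21 G12]]; last first.
  (* Every trajectory with an admissible input also occurs with [A1] as
     environment, and that environment is compatible with the first contract. *)
  split=> [E compE|S' [io impl]]; first exact: subset_trans compE A21.
  split=> // E compE [u y]; rewrite behaviour_interconnection => -[Suy Eu].
  have A2u := compE _ Eu.
  have := impl A1 (fun _ => id) (u, y); rewrite behaviour_interconnection.
  move=> /(_ (conj Suy (A21 _ A2u))) G1uy.
  by apply: G12; rewrite behaviour_interconnection.
have A21 : input_behaviour A2 `<=` input_behaviour A1 by apply: ref.1 => ?.
split=> //; have [P [Q [SE _ _]]] := implS.1; subst S.
have [M1 [Z [G1E G2E H1E H2E]]] := refines_factor ref implS.
move=> [u y]; rewrite behaviour_interconnection => -[[/= su sy G1uy] A2u].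
split=> //=; rewrite G2E (H2E _ A2u) -!mulmxA -G1E.
rewrite !(mxdiffopM Z)// G1uy; congr mxdiffop.
exact: H1E (A21 _ A2u).
Qed.
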